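(* Let $X$ be a trinomial hypersurface such that all exponents satisfy $l_{ij}\ge 2$. Then all singular $\mathrm{Aut}_{alg}(X)$-orbits of $X$ (i.e. the $\mathrm{Aut}_{alg}(X)$-orbits consisting of singular points of $X$) coincide with $\mathbb{T}$-orbits; that is, for every singular point $\alpha\in X$ the $\mathrm{Aut}_{alg}(X)$-orbit of $\alpha$ equals the $\mathbb{T}$-orbit of $\alpha$.
   Context: $\mathbb{K}$ is an algebraically closed field of characteristic zero. Fix $n=n_0+n_1+n_2$ with $n_0\ge 0$ and $n_1,n_2\ge 1$ integers, and let $T_{ij}$ ($i\in\{0,1,2\}$, $1\le j\le n_i$) be the coordinates on $\mathbb{K}^n$. A trinomial hypersurface is a subvariety $X\subset\mathbb{K}^n$ given by the equation $T_0^{l_0}+T_1^{l_1}+T_2^{l_2}=0$, where $T_i^{l_i}=T_{i1}^{l_{i1}}T_{i2}^{l_{i2}}\cdots T_{in_i}^{l_{in_i}}$ and all $l_{ij}$ are positive integers; if $n_0=0$, then $T_0^{l_0}$ means $1$. $\mathrm{Aut}_{alg}(X)$ is the subgroup of the group $\mathrm{Aut}(X)$ of regular automorphisms generated by all connected algebraic subgroups of $\mathrm{Aut}(X)$. The $n$-dimensional torus $(\mathbb{K}^\times)^n$ acts on $\mathbb{K}[T_{ij}]$ by multiplying each $T_{ij}$ by $t_{ij}$; $\mathbb{H}$ is the subgroup stabilizing the line spanned by $T_0^{l_0}+T_1^{l_1}+T_2^{l_2}$, and $\mathbb{T}$ is the neutral (identity) component of $\mathbb{H}$, a torus acting on $X$.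 *)

(* Defs.v *)
From HB Require Import structures.
From mathcomp Require Import all_boot all_algebra.
From mathcomp Require Import mpoly.

Set Implicit Arguments.
Unset Strict Implicit.
Unset Printing Implicit Defensive.

Import GRing.Theory.
Local Open Scope ring_scope.

(* Points of the affine space K^n are row vectors 'rV[K]_n; subsets of K^n
   are Prop-valued predicates. *)

Definition evalpt (K : closedFieldType) (n : nat)
    (p : {mpoly K[n]}) (x : 'rV[K]_n) : K :=
  p.@[fun i => x 0 i].

Definition polymap (K : closedFieldType) (m n : nat)
    (F : 'I_n -> {mpoly K[m]}) (x : 'rV[K]_m) : 'rV[K]_n :=
  \row_i evalpt (F i) x.

Definition zclosed (K : closedFieldType) (n : nat)
    (A : 'rV[K]_n -> Prop) : Prop :=
  exists I : {mpoly K[n]} -> Prop,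
    forall x, A x <-> (forall p, I p -> evalpt p x = 0).

(* Connectedness of an arbitrary subset S of K^n for the topology induced by
   the Zariski topology of K^n. *)
Definition zconnected (K : closedFieldType) (n : nat)
    (S : 'rV[K]_n -> Prop) : Prop :=
  forall B C : 'rV[K]_n -> Prop, zclosed B -> zclosed C ->
    (forall x, S x -> B x \/ C x) ->
    (forall x, S x -> ~ (B x /\ C x)) ->
    (forall x, S x -> B x) \/ (forall x, S x -> C x).

(* Affine algebraic groups: Zariski closed subsets of K^m with a group
   structure given by morphisms.  The functions below are only meaningful on
   the carrier. *)
Record affAlgGroup (K : closedFieldType) (m : nat) : Type := AffAlgGroup {
  ag_carrier :> 'rV[K]_m -> Prop;
  ag_one : 'rV[K]_m;
  ag_mul : 'rV[K]_m -> 'rV[K]_m -> 'rV[K]_m;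
  ag_inv : 'rV[K]_m -> 'rV[K]_m;
  ag_closed : zclosed ag_carrier;
  ag_one_in : ag_carrier ag_one;
  ag_mul_in : forall g h,
    ag_carrier g -> ag_carrier h -> ag_carrier (ag_mul g h);
  ag_inv_in : forall g, ag_carrier g -> ag_carrier (ag_inv g);
  ag_mulA : forall g h k, ag_carrier g -> ag_carrier h -> ag_carrier k ->
    ag_mul g (ag_mul h k) = ag_mul (ag_mul g h) k;
  ag_mul1g : forall g, ag_carrier g -> ag_mul ag_one g = g;
  ag_mulVg : forall g, ag_carrier g -> ag_mul (ag_inv g) g = ag_one;
  ag_mul_regular : exists F : 'I_m -> {mpoly K[m + m]},
    forall g h, ag_carrier g -> ag_carrier h ->
      ag_mul g h = polymap F (row_mx g h);
  ag_inv_regular : exists F : 'I_m -> {mpoly K[m]},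
    forall g, ag_carrier g -> ag_inv g = polymap F g
}.

Definition hypersurface (K : closedFieldType) (n : nat)
    (f : {mpoly K[n]}) : Type :=
  {x : 'rV[K]_n | evalpt f x == 0}.

Definition regular_self_map (K : closedFieldType) (n : nat)
    (f : {mpoly K[n]}) (phi : hypersurface f -> hypersurface f) : Prop :=
  exists F : 'I_n -> {mpoly K[n]}, forall x, val (phi x) = polymap F (val x).

Definition regular_aut (K : closedFieldType) (n : nat)
    (f : {mpoly K[n]}) (phi : hypersurface f -> hypersurface f) : Prop :=
  regular_self_map phi /\
  exists psi, [/\ regular_self_map psi, cancel phi psi & cancel psi phi].

(* S is a set of automorphisms which carries a structure of connected
   algebraic group G such that the action map G x X -> X is a morphism; act
   is the resulting group isomorphism from G onto S. *)
Definition connected_algebraic_subgroup (K : closedFieldType) (n : nat)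
    (f : {mpoly K[n]}) (S : (hypersurface f -> hypersurface f) -> Prop)
    : Prop :=
  (forall phi, S phi -> regular_aut phi) /\
  exists (m : nat) (G : affAlgGroup K m)
         (act : 'rV[K]_m -> hypersurface f -> hypersurface f),
    zconnected G /\
    (forall x, act (ag_one G) x = x) /\
    (forall g h x, G g -> G h -> act (ag_mul G g h) x = act g (act h x)) /\
    (exists F : 'I_n -> {mpoly K[m + n]}, forall g x, G g ->
       val (act g x) = polymap F (row_mx g (val x))) /\
    (forall g h, G g -> G h -> act g =1 act h -> g = h) /\
    (forall phi, S phi <-> exists2 g, G g & phi =1 act g).

Inductive Aut_alg (K : closedFieldType) (n : nat) (f : {mpoly K[n]}) :
    (hypersurface f -> hypersurface f) -> Prop :=
| Aut_alg_gen S phi :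
    connected_algebraic_subgroup S -> S phi -> Aut_alg phi
| Aut_alg_id : Aut_alg id
| Aut_alg_comp phi psi : Aut_alg phi -> Aut_alg psi -> Aut_alg (phi \o psi)
| Aut_alg_inv phi psi :
    Aut_alg phi -> cancel phi psi -> cancel psi phi -> Aut_alg psi.

Definition Aut_alg_orbit (K : closedFieldType) (n : nat) (f : {mpoly K[n]})
    (a : hypersurface f) (b : 'rV[K]_n) : Prop :=
  exists2 phi : hypersurface f -> hypersurface f,
    Aut_alg phi & val (phi a) = b.

Definition vanishing_ideal (K : closedFieldType) (n : nat)
    (A : 'rV[K]_n -> Prop) (p : {mpoly K[n]}) : Prop :=
  forall x, A x -> evalpt p x = 0.

Definition tangent_vector (K : closedFieldType) (n : nat)
    (A : 'rV[K]_n -> Prop) (a v : 'rV[K]_n) : Prop :=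
  forall p, vanishing_ideal A p -> \sum_i evalpt p^`M(i) a * v 0 i = 0.

(* The tangent space at a (the row space of U) has dimension greater than
   n - 1, the dimension of a hypersurface of K^n. *)
Definition singular_point (K : closedFieldType) (n : nat)
    (f : {mpoly K[n]}) (a : hypersurface f) : Prop :=
  exists U : 'M[K]_n,
    (forall v : 'rV[K]_n,
       (v <= U)%MS <-> tangent_vector (fun x => evalpt f x = 0) (val a) v) /\
    (n.-1 < \rank U)%N.

Definition torus_act_poly (K : closedFieldType) (n : nat)
    (t : 'rV[K]_n) (p : {mpoly K[n]}) : {mpoly K[n]} :=
  p \mPo [tuple t 0 i *: 'X_i | i < n].

Definition torusH (K : closedFieldType) (n : nat)
    (f : {mpoly K[n]}) (t : 'rV[K]_n) : Prop :=
  (forall i, t 0 i != 0) /\ exists c : K, torus_act_poly t f = c *: f.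

(* The connected component of the identity (1, ..., 1) in torusH f. *)
Definition torusT (K : closedFieldType) (n : nat)
    (f : {mpoly K[n]}) (t : 'rV[K]_n) : Prop :=
  exists S : 'rV[K]_n -> Prop,
    [/\ forall s, S s -> torusH f s, zconnected S, S (const_mx 1) & S t].

Definition torusT_orbit (K : closedFieldType) (n : nat)
    (f : {mpoly K[n]}) (a b : 'rV[K]_n) : Prop :=
  exists2 t, torusT f t & b = \row_i (t 0 i * a 0 i).

(* The coordinates T_0j, T_1j, T_2j are the variables of the successive blocks
   of sizes n0, n1, n2; for n0 = 0 the first monomial is the empty product 1. *)
Definition trinomial (K : closedFieldType) (n0 n1 n2 : nat)
    (l0 : 'I_n0 -> nat) (l1 : 'I_n1 -> nat) (l2 : 'I_n2 -> nat)
    : {mpoly K[n0 + n1 + n2]} :=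
  \prod_(j < n0) 'X_(lshift n2 (lshift n1 j)) ^+ l0 j
  + \prod_(j < n1) 'X_(lshift n2 (rshift n0 j)) ^+ l1 j
  + \prod_(j < n2) 'X_(rshift (n0 + n1) j) ^+ l2 j.

(* Main.v *)
Require Import Defs.
From mathcomp Require Import all_boot all_algebra.
From mathcomp Require Import mpoly.
From Stdlib Require Import Classical.

Set Implicit Arguments.
Unset Strict Implicit.
Unset Printing Implicit Defensive.

Import GRing.Theory.
Local Open Scope ring_scope.

(** Write f for the trinomial and X for the hypersurface f = 0.  The variables
    fall into three blocks, one for each monomial, and everything rests on the
    zero patterns of points.

    Since all exponents are at least 2, the gradient of f vanishes at a point
    of X exactly when each block contains a variable that is zero there (an
    empty block contributes the constant 1, so it admits no singular point at
    all).  Hence the singular locus is the union of the coordinate subspaces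
    obtained by choosing one variable in each block and setting the chosen
    ones to zero ([stratum]).  The vanishing ideal of X could a priori exceed
    the ideal generated by f; [zero_in_blocks_full_tangent] shows that all its
    elements are nevertheless singular at these points.

    An automorphism of X preserves singular points ([full_tangent_iso]), so it
    permutes the strata ([regular_aut_stratum]), which are the irreducible
    components of the singular locus.  A connected group acts trivially on
    this finite set ([connected_group_stratum]).  A coordinate that vanishes
    at a singular point can be completed to a stratum through that point, so
    the set of zero coordinates of a singular point is invariant under
    [Aut_alg] ([Aut_alg_same_zeros]).

    Conversely, two singular points with the same zero coordinates are joined
    by one-parameter subgroups of the torus: a nonzero coordinate is moved to
    any nonzero value while the weights of the zero coordinates, one in each
    block, are adjusted so that f is only rescaled ([exists_weights],
    [same_zeros_ind]).  These subgroups lie in the connected torus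
    ([torusT_one_param]), and they are connected algebraic groups of
    automorphisms ([one_param_Aut_alg]).  Therefore both kinds of orbits of a
    singular point consist of the points with the same zero coordinates.

    The argument does not see the number of blocks, so it is carried out for
    sums of at least two monomials in disjoint sets of variables
    ([block_poly]). *)

(** * Polynomials along curves *)

Lemma mpoly_gen_ind n (R : comNzRingType) (P : {mpoly R[n]} -> Prop) :
  (forall c, P c%:MP) -> (forall i, P 'X_i) ->
  (forall p q, P p -> P q -> P (p + q)) ->
  (forall p q, P p -> P q -> P (p * q)) -> forall p, P p.
Proof.
move=> PC PX PD PM; elim/mpolyind => [|c m p _ _ Pp]; first by rewrite -mpolyC0.
apply: (PD) => //; rewrite -mul_mpolyC; apply: (PM) => //; rewrite mpolyXE_id.
elim/big_ind: _ => //= [|i _]; first by rewrite -mpolyC1.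
by elim: (m i) => [|k IH]; rewrite ?exprS ?expr0 -?mpolyC1 //; apply: PM.
Qed.

(** The chain rule: both sides are derivations in [p], so the generators
    decide.  It is used for univariate substitutions (curves) and for
    multivariate ones (polynomial maps). *)
Lemma mmap_derivation n (R S : comNzRingType) (h : {rmorphism R -> S})
    (c : 'I_n -> S) (D : S -> S) :
  {morph D : x y / x + y} -> (forall x y, D (x * y) = D x * y + x * D y) ->
  (forall a, D (h a) = 0) ->
  forall p, D (mmap h c p) = \sum_i mmap h c p^`M(i) * D (c i).
Proof.
move=> DD DM Dh; apply: mpoly_gen_ind => [a|i|p q Hp Hq|p q Hp Hq].
- by rewrite mmapC Dh big1 // => i _; rewrite mderivC rmorph0 mul0r.
- rewrite mmapX mmap1U (bigD1 i) //= mderivX mnm1E eqxx scale1r.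
  rewrite -{1}[U_(i)%MM]addm0 addmC addmK mpolyX0 rmorph1 mul1r.
  rewrite big1 ?addr0 // => j ji; rewrite mderivX mnm1E eq_sym (negPf ji) scale0r.
  by rewrite rmorph0 mul0r.
- rewrite rmorphD DD Hp Hq -big_split; apply: eq_bigr => i _.
  by rewrite mderivD rmorphD mulrDl.
rewrite rmorphM DM Hp Hq mulr_suml mulr_sumr -big_split; apply: eq_bigr => i _ /=.
by rewrite mderivM rmorphD !rmorphM mulrDl mulrAC mulrA.
Qed.

Lemma rmorph_mmap n (R S S' : comNzRingType) (phi : {rmorphism S -> S'})
    (h : R -> S) (c : 'I_n -> S) (h' : R -> S') (c' : 'I_n -> S') p :
  (forall a, phi (h a) = h' a) -> (forall i, phi (c i) = c' i) ->
  phi (mmap h c p) = mmap h' c' p.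
Proof.
move=> eh ec; rewrite rmorph_sum; apply: eq_bigr => m _.
rewrite rmorphM eh /mmap1 rmorph_prod; congr (_ * _).
by apply: eq_bigr => i _; rewrite rmorphXn ec.
Qed.

Section Curves.
Context (K : closedFieldType) (n : nat).
Implicit Types (p : {mpoly K[n]}) (x v : 'rV[K]_n) (c : 'I_n -> {poly K}).

Definition along c p : {poly K} := mmap polyC c p.

Lemma horner_along c p t : (along c p).[t] = evalpt p (\row_i (c i).[t]).
Proof.
rewrite -[LHS]horner_evalE; apply: rmorph_mmap => [a|i].
  by rewrite /= horner_evalE hornerC.
by rewrite /= horner_evalE mxE.
Qed.

Lemma deriv_along c p :
  (along c p)^`() = \sum_i along c p^`M(i) * (c i)^`().
Proof.
apply: mmap_derivation => [q r|q r|a]; first exact: derivD.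
- exact: derivM.
- exact: derivC.
Qed.

Lemma gradient_along c p (x : 'rV[K]_n) t : (forall i, (c i).[t] = x 0 i) ->
  (along c p)^`().[t] = \sum_i evalpt p^`M(i) x * (c i)^`().[t].
Proof.
move=> cx; rewrite deriv_along horner_sum; apply: eq_bigr => i _.
rewrite hornerM horner_along; congr (evalpt _ _ * _).
by apply/rowP=> j; rewrite mxE cx.
Qed.

Lemma poly_eq0_off (P Q : {poly K}) :
  Q != 0 -> (forall t, Q.[t] != 0 -> P.[t] = 0) -> P = 0.
Proof.
move=> Q0 PQ; have [//|P0] := eqVneq P 0.
have /closed_nonrootP[t] : P * Q != 0 by rewrite mulf_neq0.
rewrite /root hornerM; have [->|Qt] := eqVneq Q.[t] 0; first by rewrite mulr0 eqxx.
by rewrite PQ // mul0r eqxx.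
Qed.

Lemma along_eq0 c p : (forall t, evalpt p (\row_i (c i).[t]) = 0) -> along c p = 0.
Proof.
by move=> H; apply: (@poly_eq0_off _ 1) => [|t _]; rewrite ?oner_eq0 ?horner_along.
Qed.

Definition line x v (i : 'I_n) : {poly K} := (x 0 i)%:P + v 0 i *: 'X.

Lemma horner_line x v t i : (line x v i).[t] = x 0 i + t * v 0 i.
Proof. by rewrite /line !hornerE mulrC. Qed.

Lemma deriv_line x v i : (line x v i)^`() = (v 0 i)%:P.
Proof. by rewrite /line derivD derivC derivZ derivX add0r alg_polyC. Qed.

(** Gradients are read off from restrictions to lines. *)
Lemma gradient_line x v p :
  \sum_i evalpt p^`M(i) x * v 0 i = (along (line x v) p)^`().[0].
Proof.
rewrite (@gradient_along _ _ x) => [|i].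
  by apply: eq_bigr => i _; rewrite deriv_line hornerC.
by rewrite horner_line mul0r addr0.
Qed.

(** The irreducibility of a subset [A] closed under taking lines: nonvanishing
    points of two polynomials are joined by a line, on which each of the two
    has only finitely many zeros. *)
Lemma common_nonvanishing (I : eqType) (s : seq I) (F : I -> {mpoly K[n]})
    (A : 'rV[K]_n -> Prop) :
  (exists x, A x) ->
  (forall x y t, A x -> A y -> A (\row_i (line x (y - x) i).[t])) ->
  (forall j, j \in s -> exists2 x, A x & evalpt (F j) x != 0) ->
  exists2 x, A x & forall j, j \in s -> evalpt (F j) x != 0.
Proof.
move=> A0 Aline; elim: s => [|j s IH] Hs; first by case: A0 => x; exists x.
have [|x Ax xs] := IH; first by move=> k ks; apply: Hs; rewrite inE ks orbT.
have [y Ay yj] := Hs j (mem_head _ _).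
pose c := line x (y - x).
have c0 : (\row_i (c i).[0]) = x.
  by apply/rowP=> i; rewrite mxE horner_line mul0r addr0.
have c1 : (\row_i (c i).[1]) = y.
  by apply/rowP=> i; rewrite mxE horner_line mul1r !mxE subrKC.
have /closed_nonrootP[t] :
    along c (F j) * \prod_(k <- s) along c (F k) != 0.
  rewrite mulf_neq0 //.
    apply: contraNneq yj => cj0; apply/eqP.
    by rewrite -c1 -horner_along cj0 horner0.
  rewrite prodf_seq_neq0; apply/allP=> k ks; apply: contraNneq (xs k ks) => ck0.
  by rewrite -c0 -horner_along ck0 horner0.
rewrite /root hornerM horner_prod mulf_eq0 negb_or => /andP[tj].
rewrite prodf_seq_neq0 => /allP ts.
exists (\row_i (c i).[t]); first exact: Aline.
move=> k; rewrite inE -horner_along => /orP[/eqP-> //|/ts //].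
Qed.

(** Over the ring of polynomials in t, the polynomial [p] with all coordinates
    but the [i]-th taken on the curve has the two distinct roots [c i] and
    [zeta *: c i].  Both vanish at t = 0, where they form a double root, and a
    double root kills the derivative. *)
Lemma double_root_gradient i (zeta : K) c (x : 'rV[K]_n) p :
  zeta != 1 -> c i != 0 -> x 0 i = 0 -> (forall j, (c j).[0] = x 0 j) ->
  along c p = 0 ->
  along (fun j => if j == i then zeta *: c i else c j) p = 0 ->
  evalpt p^`M(i) x = 0.
Proof.
move=> zeta1 ci0 xi0 cx pc pzc.
(* The outer variable stands for the i-th coordinate, the inner one for t. *)
pose C j : {poly {poly K}} := if j == i then 'X else (c j)%:P.
pose P := mmap (polyC \o polyC) C p.
have rootP u : P.[u] = along (fun j => if j == i then u else c j) p.
  rewrite -horner_evalE; apply: rmorph_mmap => [a|j].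
    by rewrite /= horner_evalE hornerC.
  by rewrite /= horner_evalE /C; case: eqP; rewrite ?hornerX ?hornerC.
have P1 : root P (c i).
  apply/eqP; rewrite rootP -[RHS]pc.
  apply: (@rmorph_mmap _ _ _ _ idfun) => //= j; case: eqP => [->|] //.
have P2 : root P (zeta *: c i) by apply/eqP; rewrite rootP.
have /factor_theorem[Q1 PQ1] := P1.
have /factor_theorem[Q Q1Q] : root Q1 (zeta *: c i).
  move: P2; rewrite PQ1 rootM root_XsubC => /orP[//|].
  by rewrite -{2}[c i]scale1r -subr_eq0 -scalerBl scaler_eq0 subr_eq0
    (negPf zeta1) (negPf ci0).
pose d j : {poly K} := if j == i then 'X else (x 0 j)%:P.
have eP : along d p = map_poly (horner_eval 0) P.
  apply/esym; apply: rmorph_mmap => [a|j].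
    by rewrite /= !map_polyC /= /horner_eval hornerC.
  rewrite /C /d; case: eqP => _ /=; first by rewrite map_polyX.
  by rewrite map_polyC /= /horner_eval cx.
have dx j : (d j).[0] = x 0 j.
  by rewrite /d; case: eqP => [->|]; rewrite ?hornerX ?hornerC ?xi0.
have := gradient_along p dx; rewrite (bigD1 i) //= big1 => [|j ji]; last first.
  by rewrite /d (negPf ji) derivC hornerC mulr0.
have -> : d i = 'X by rewrite /d eqxx.
rewrite derivX hornerC mulr1 addr0 => <-.
rewrite eP PQ1 Q1Q !rmorphM /= !rmorphB /= !map_polyX !map_polyC /= /horner_eval.
rewrite hornerZ cx xi0 mulr0 subr0 derivM hornerD !hornerM derivX hornerC hornerX.
by rewrite !mulr0 add0r mul0r.
Qed.

End Curves.

(** * Singular points of a sum of monomials in disjoint variables *)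

Definition block_poly (K : closedFieldType) n r (blk : 'I_n -> 'I_r)
    (l : 'I_n -> nat) : {mpoly K[n]} :=
  \sum_k \prod_(j | blk j == k) 'X_j ^+ l j.

(** Singularity of a point of a hypersurface, stated without ranks: then it is
    visibly transported by isomorphisms. *)
Definition full_tangent (K : closedFieldType) n (A : 'rV[K]_n -> Prop)
    (x : 'rV[K]_n) : Prop :=
  forall v, tangent_vector A x v.

Definition zero_in_blocks (K : closedFieldType) n r (blk : 'I_n -> 'I_r)
    (x : 'rV[K]_n) : Prop :=
  forall k, exists2 i, blk i = k & x 0 i = 0.

Lemma singular_full_tangent (K : closedFieldType) n (f : {mpoly K[n]})
    (a : hypersurface f) :
  singular_point a -> full_tangent (fun x => evalpt f x = 0) (val a).
Proof.
case=> U [UE]; case: n f a U UE => [|n] f a U UE ltU v.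
  by have := leq_trans ltU (rank_leq_row U); rewrite ltnn.
apply/UE/submx_full; rewrite /row_full eqn_leq rank_leq_col; exact: ltU.
Qed.

Lemma prod_eq0_exists (K : closedFieldType) n (P : pred 'I_n) (x : 'rV[K]_n) l :
  \prod_(j | P j) x 0 j ^+ l j = 0 -> exists2 j, P j & x 0 j = 0.
Proof.
case/eqP/prodf_eq0=> j Pj; rewrite expf_eq0 => /andP[_ /eqP xj0]; by exists j.
Qed.

(** A root of 1 + X + ... + X^(m-1); it is not 1 because [m] is nonzero in
    characteristic zero. *)
Lemma unity_root_exists (K : closedFieldType) (charK0 : [pchar K] =i pred0) m :
  (1 < m)%N -> exists2 zeta : K, zeta != 1 & zeta ^+ m = 1.
Proof.
move=> m1; pose P : {poly K} := \poly_(i < m) 1.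
have szP : size P = m by rewrite size_poly_eq ?oner_eq0.
have /closed_rootP[z rz] : size P != 1 by rewrite szP neq_ltn m1 orbT.
have hz : \sum_(i < m) z ^+ i = 0.
  move/eqP: rz; rewrite /P horner_poly => {2}<-.
  by apply: eq_bigr => i _; rewrite mul1r.
exists z; last first.
  by apply/eqP; rewrite -subr_eq0 subrX1 hz mulr0.
apply/eqP => z1; move/eqP: hz; rewrite z1.
under eq_bigr do rewrite expr1n.
rewrite sumr_const card_ord; have /pcharf0P-> := charK0.
by rewrite gtn_eqF // ltnW.
Qed.

Lemma root_exists (K : closedFieldType) (a : K) m :
  (0 < m)%N -> exists b : K, b ^+ m = a.
Proof.
case: m => // m _.
have [b bE] := @solve_monicpoly K m.+1 (fun i => if i == 0%N then a else 0) isT.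
exists b; rewrite bE big_ord_recl /= expr0 mulr1 big1 ?addr0 // => i _.
by rewrite mul0r.
Qed.

Section Blocks.
Context (K : closedFieldType) (n r : nat) (blk : 'I_n -> 'I_r) (l : 'I_n -> nat).
Local Notation f := (block_poly K blk l).
Local Notation X := (fun x => evalpt f x = 0).
Implicit Types (x v : 'rV[K]_n).

Lemma mmap_block_poly (S : comNzRingType) (h : {rmorphism K -> S}) c :
  mmap h c f = \sum_k \prod_(j | blk j == k) c j ^+ l j.
Proof.
rewrite rmorph_sum; apply: eq_bigr => k _; rewrite rmorph_prod.
by apply: eq_bigr => j _; rewrite rmorphXn /= mmapX mmap1U.
Qed.

Lemma evalpt_block_poly x :
  evalpt f x = \sum_k \prod_(j | blk j == k) x 0 j ^+ l j.
Proof. exact: (@mmap_block_poly K idfun). Qed.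

Lemma along_block_poly c :
  along c f = \sum_k \prod_(j | blk j == k) c j ^+ l j.
Proof. exact: mmap_block_poly. Qed.

Context (l_gt0 : forall j, (0 < l j)%N).

Lemma zero_in_blocks_hypersurface x : zero_in_blocks blk x -> X x.
Proof.
move=> xb; rewrite /= evalpt_block_poly big1 // => k _.
have [i ik xi] := xb k; apply/eqP/prodf_eq0; exists i; first exact/eqP.
by rewrite expf_eq0 l_gt0 xi /=.
Qed.

Context (charK0 : [pchar K] =i pred0).

(** The derivative of [f] along a variable of a block shows that the monomial
    of a nonempty block vanishes.  Then [f] takes at [x] the number of empty
    blocks as its value, so in characteristic zero there are none. *)
Lemma full_tangent_zero_in_blocks x :
  X x -> full_tangent X x -> zero_in_blocks blk x.
Proof.
move=> Xx tx.
have nonempty i : exists2 j, blk j = blk i & x 0 j = 0.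
  pose d : 'rV[K]_n := delta_mx 0 i.
  have := tx d f (fun y => id); rewrite gradient_line along_block_poly.
  rewrite raddf_sum /= horner_sum (bigD1 (blk i)) //=.
  rewrite [X in _ + X]big1 ?addr0 => [|k ki]; last first.
    have -> : \prod_(j | blk j == k) line x d j ^+ l j
            = (\prod_(j | blk j == k) x 0 j ^+ l j)%:P.
      rewrite rmorph_prod; apply: eq_bigr => j /eqP jk; rewrite /line mxE eqxx.
      case: eqP => [ji|_]; last by rewrite scale0r addr0 rmorphXn.
      by rewrite -jk ji eqxx in ki.
    by rewrite derivC hornerC.
  rewrite (bigD1 i) //=.
  have -> : \prod_(j | (blk j == blk i) && (j != i)) line x d j ^+ l j
          = (\prod_(j | (blk j == blk i) && (j != i)) x 0 j ^+ l j)%:P.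
    rewrite rmorph_prod; apply: eq_bigr => j /andP[_ ji]; rewrite /line mxE.
    by rewrite (negPf ji) andbF scale0r addr0 rmorphXn.
  rewrite mulrC deriv_mulC hornerCM deriv_exp deriv_line hornerMn hornerM hornerC.
  rewrite horner_exp horner_line mul0r addr0 mxE !eqxx mul1r -mulr_natr mulrA.
  move/eqP; rewrite !mulf_eq0; have /pcharf0P-> := charK0.
  rewrite -(negbK (l i == 0)%N) -lt0n l_gt0 orbF => /orP[/eqP/prod_eq0_exists|].
    by case=> j /andP[/eqP ji _] xj; exists j.
  by rewrite expf_eq0 => /andP[_ /eqP]; exists i.
pose b k := [exists j, (blk j == k) && (x 0 j == 0)].
have bE k : \prod_(j | blk j == k) x 0 j ^+ l j = (~~ b k)%:R.
  case: (boolP (b k)) => [/existsP[j /andP[jk xj]]|nb].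
    by apply/eqP/prodf_eq0; exists j; rewrite // expf_eq0 l_gt0 xj.
  rewrite big_pred0 // => i; apply: contraNF nb => /eqP <-.
  have [j ji xj] := nonempty i.
  by apply/existsP; exists j; rewrite ji xj !eqxx.
move: Xx; rewrite /= evalpt_block_poly; under eq_bigr do rewrite bE.
rewrite -natr_sum => /eqP; have /pcharf0P-> := charK0.
rewrite sum_nat_eq0 => /forallP bP k; have := bP k; rewrite eqb0 negbK.
by case/existsP=> j /andP[/eqP jk /eqP xj]; exists j.
Qed.

Context (l_gt1 : forall j, (1 < l j)%N) (r_gt1 : (1 < r)%N).

(** The curve moves the zero coordinates of two blocks only, the block of [i]
    and another one.  Let [N k] be the order of vanishing of the monomial of
    block [k] when the zero coordinates of [x] are replaced by t.  Replacing
    those of each of the two blocks by t to the power [N] of the other block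
    makes both monomials a constant times the same power of t; the factor
    [beta] makes these constants opposite.  The remaining blocks keep a zero
    coordinate. *)
Lemma zero_in_blocks_curve x i : zero_in_blocks blk x -> x 0 i = 0 ->
  exists c : 'I_n -> {poly K},
    [/\ c i != 0, forall j, (c j).[0] = x 0 j & along c f = 0].
Proof.
move=> xb xi.
have [k' k'i] : exists k', k' != blk i.
  apply/existsP; rewrite -negb_forall; apply: contraL r_gt1 => /forallP ri.
  rewrite -[r]card_ord -leqNgt; apply/card_le1P=> u _ w.
  by rewrite !inE (eqP (ri u)) (eqP (ri w)) eqxx.
have [i' i'k xi'] := xb k'.
pose N k := \sum_(j | (blk j == k) && (x 0 j == 0)) l j.
have N_gt0 j : x 0 j = 0 -> (0 < N (blk j))%N.
  by move=> xj; rewrite /N (bigD1 j) ?xj ?eqxx //= addn_gt0 l_gt0.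
pose A : K := \prod_(j | blk j == blk i) (if x 0 j == 0 then 1 else x 0 j) ^+ l j.
pose B : K := \prod_(j | blk j == k') (if x 0 j == 0 then 1 else x 0 j) ^+ l j.
have [A0 B0] : A != 0 /\ B != 0.
  by split; apply/prodf_neq0 => j _; apply: expf_neq0; case: ifP => [_|->];
     rewrite ?oner_neq0.
have [beta betaE] := root_exists (- A / B) (l_gt0 i').
pose w j := if x 0 j != 0 then x 0 j else if blk j == blk i then 1
            else if blk j == k' then (if j == i' then beta else 1) else 0.
pose e j := if x 0 j != 0 then 0%N else if blk j == blk i then N k' else N (blk i).
exists (fun j => w j *: 'X^(e j)); split.
- by rewrite /w xi !eqxx scale1r -size_poly_eq0 size_polyXn.
- move=> j; rewrite hornerZ hornerXn /w /e.
  case: eqP => [xj|_] /=; last by rewrite mulr1.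
  rewrite xj; case: eqP => ji.
    by rewrite expr0n -i'k (negPf (lt0n_neq0 (N_gt0 i' xi'))) mulr0.
  by rewrite expr0n (negPf (lt0n_neq0 (N_gt0 i xi))) mulr0.
rewrite along_block_poly (bigD1 (blk i)) //= (bigD1 k') //=.
rewrite [X in _ + (_ + X)]big1 ?addr0 => [|k /andP[ki kk']]; last first.
  have [j jk xj] := xb k; apply/eqP/prodf_eq0; exists j; first exact/eqP.
  by rewrite /w xj eqxx jk (negPf ki) (negPf kk') scale0r expf_eq0 l_gt0 /=.
have monomE k : \prod_(j | blk j == k) (w j *: 'X^(e j) : {poly K}) ^+ l j
    = (\prod_(j | blk j == k) w j ^+ l j)
      *: 'X^(\sum_(j | blk j == k) e j * l j).
  rewrite -mul_polyC rmorph_prod.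
  rewrite (big_morph (fun m => 'X^m : {poly K}) (id1 := 1) (op1 := *%R)
             (fun a b => exprD _ a b) (expr0 _)) -big_split.
  by apply: eq_bigr => j _; rewrite exprZn -exprM -mul_polyC.
rewrite !monomE.
have -> : (\sum_(j | blk j == blk i) e j * l j = N k' * N (blk i))%N.
  rewrite {2}/N big_distrr /= big_mkcondr /=; apply: eq_bigr => j /eqP jk.
  by rewrite /e; case: eqP => _ /=; rewrite ?mul0n // jk eqxx.
have -> : (\sum_(j | blk j == k') e j * l j = N k' * N (blk i))%N.
  rewrite [RHS]mulnC {2}/N big_distrr /= big_mkcondr /=.
  apply: eq_bigr => j /eqP jk.
  by rewrite /e; case: eqP => _ /=; rewrite ?mul0n // jk (negPf k'i).
rewrite -scalerDl.
have -> : \prod_(j | blk j == blk i) w j ^+ l j = A.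
  apply: eq_bigr => j /eqP ji; rewrite /w.
  by case: eqP => _ //=; rewrite ji eqxx.
have -> : \prod_(j | blk j == k') w j ^+ l j = beta ^+ l i' * B.
  rewrite (bigD1 i') ?i'k //= /B [in RHS](bigD1 i') ?i'k //= xi' eqxx expr1n mul1r.
  rewrite /w xi' eqxx i'k (negPf k'i) !eqxx /=; congr (_ * _).
  apply: eq_bigr => j /andP[/eqP jk ji'].
  by case: eqP => //= _; rewrite jk (negPf k'i) eqxx (negPf ji').
by rewrite betaE divfK // subrr scale0r.
Qed.

(** Along a nonzero coordinate of [x], the line through [x] stays inside the
    hypersurface.  Along a zero coordinate, the hypersurface need not contain a
    smooth curve with the required velocity (as for x^2 + y^3 + z^5), so the
    symmetry multiplying that coordinate by a root of unity is used instead. *)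
Lemma zero_in_blocks_full_tangent x : zero_in_blocks blk x -> full_tangent X x.
Proof.
move=> xb v p pX; rewrite big1 // => i _.
suff -> : evalpt p^`M(i) x = 0 by rewrite mul0r.
have [xi|xi] := eqVneq (x 0 i) 0; last first.
  have : along (line x (delta_mx 0 i)) p = 0.
    apply: along_eq0 => t; apply/pX/zero_in_blocks_hypersurface => k.
    have [j jk xj] := xb k; exists j; rewrite // mxE horner_line xj add0r mxE eqxx.
    by case: eqP => [ji|]; rewrite ?mulr0 // -ji xj eqxx in xi *.
  move/(congr1 (fun q => q^`().[0])); rewrite -gradient_line deriv0 horner0 => <-.
  rewrite (bigD1 i) //= mxE !eqxx mulr1 big1 ?addr0 // => j ji.
  by rewrite mxE (negPf ji) andbF mulr0.
have [c [ci cx cf]] := zero_in_blocks_curve xb xi.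
have [zeta zeta1 zetal] := unity_root_exists charK0 (l_gt1 i).
apply: (double_root_gradient zeta1 ci xi cx).
  by apply: along_eq0 => t; apply: pX; rewrite -horner_along cf horner0.
apply: along_eq0 => t; apply: pX; rewrite -horner_along.
rewrite -[RHS](horner0 t) -cf !along_block_poly; congr (_.[_]).
apply: eq_bigr => k _; apply: eq_bigr => j _; case: eqP => // ->.
by rewrite exprZn zetal scale1r.
Qed.

End Blocks.

(** * Automorphisms and connected groups on the singular locus *)

Lemma evalpt_mmap (K : closedFieldType) m n (F : 'I_n -> {mpoly K[m]}) p x :
  evalpt (mmap (@mpolyC m K) F p) x = evalpt p (polymap F x).
Proof.
apply: (@rmorph_mmap _ _ _ _ (meval (fun i => x 0 i))) => [a|i] /=.
  exact: mevalC.
by rewrite mxE.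
Qed.

Lemma gradient_mmap (K : closedFieldType) m n (F : 'I_n -> {mpoly K[m]}) p x j :
  evalpt (mmap (@mpolyC m K) F p)^`M(j) x
  = \sum_i evalpt p^`M(i) (polymap F x) * evalpt (F i)^`M(j) x.
Proof.
rewrite (@mmap_derivation _ _ _ _ _ (mderiv j)) => [|q r|q r|a]; last 3 first.
- exact: mderivD.
- exact: mderivM.
- exact: mderivC.
rewrite /evalpt rmorph_sum; apply: eq_bigr => i _.
by rewrite rmorphM; congr (_ * _); apply: evalpt_mmap.
Qed.

Lemma full_tangent_partial (K : closedFieldType) n (A : 'rV[K]_n -> Prop) x p i :
  full_tangent A x -> vanishing_ideal A p -> evalpt p^`M(i) x = 0.
Proof.
move=> tx pA; have := tx (delta_mx 0 i) p pA.
rewrite (bigD1 i) //= mxE !eqxx mulr1 big1 ?addr0 // => j ji.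
by rewrite mxE (negPf ji) andbF mulr0.
Qed.

(** The components of G o F - id lie in the vanishing ideal of [A], hence have
    zero gradient at [x]: the Jacobian matrices of [F] and [G] are inverse to
    each other.  The Jacobian matrix of [F] sends gradients at [polymap F x] to
    gradients at [x], which are zero. *)
Lemma full_tangent_iso (K : closedFieldType) n (A : 'rV[K]_n -> Prop)
    (F G : 'I_n -> {mpoly K[n]}) x :
  (forall y, A y -> A (polymap F y)) ->
  (forall y, A y -> polymap G (polymap F y) = y) ->
  full_tangent A x -> full_tangent A (polymap F x).
Proof.
move=> FA GF tx v p pA.
pose J := \matrix_(i, j) evalpt (F i)^`M(j) x.
pose J' := \matrix_(i, j) evalpt (G i)^`M(j) (polymap F x).
have J'J : J' *m J = 1%:M.
  apply/matrixP=> k j; rewrite !mxE.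
  have : evalpt (mmap (@mpolyC n K) F (G k) - 'X_k)^`M(j) x = 0.
    apply: (full_tangent_partial _ tx) => y Ay.
    rewrite /evalpt rmorphB /= mevalXU; apply/eqP; rewrite subr_eq0; apply/eqP.
    by rewrite -[in RHS](GF y) // mxE; apply: evalpt_mmap.
  rewrite mderivB /evalpt rmorphB => /eqP; rewrite subr_eq0.
  rewrite [X in X == _]gradient_mmap => /eqP E.
  under eq_bigr do rewrite !mxE.
  rewrite E mderivX mnm1E; case: eqP => [->|_].
    by rewrite scale1r -{1}[U_(j)%MM]add0m addmK mpolyX0 rmorph1.
  by rewrite /= scale0r meval0.
pose g := \row_i evalpt p^`M(i) (polymap F x).
have gJ : g *m J = 0.
  apply/rowP=> j; rewrite !mxE.
  under eq_bigr do rewrite !mxE.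
  rewrite -gradient_mmap; apply: (full_tangent_partial _ tx) => y Ay.
  by rewrite evalpt_mmap; apply/pA/FA.
have g0 : g = 0 by rewrite -[g]mulmx1 -(mulmx1C J'J) mulmxA gJ mul0mx.
by rewrite big1 // => i _; move/rowP/(_ i): g0; rewrite !mxE => ->; rewrite mul0r.
Qed.

Lemma zclosedU (K : closedFieldType) n (A B : 'rV[K]_n -> Prop) :
  zclosed A -> zclosed B -> zclosed (fun x => A x \/ B x).
Proof.
move=> [I AI] [J BJ].
exists (fun p => exists q1 q2, [/\ I q1, J q2 & p = q1 * q2]) => x; split.
  case=> [/AI Ax|/BJ Bx] p [q1 [q2 [I1 J2 ->]]]; rewrite /evalpt mevalM.
    by rewrite [q1.@[_]](Ax _ I1) mul0r.
  by rewrite [q2.@[_]](Bx _ J2) mulr0.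
move=> H; case: (classic (A x)) => [|nA]; first by left.
right; apply/BJ => q2 J2; apply: NNPP => q2x; apply: nA; apply/AI => q1 I1.
have /eqP := H _ (ex_intro _ q1 (ex_intro _ q2 (And3 I1 J2 erefl))).
by rewrite /evalpt mevalM mulf_eq0 => /orP[/eqP|/eqP].
Qed.

Lemma zclosed_bigU (K : closedFieldType) n (I : eqType) (s : seq I)
    (A : I -> 'rV[K]_n -> Prop) :
  (forall j, zclosed (A j)) -> zclosed (fun x => exists2 j, j \in s & A j x).
Proof.
move=> Acl; elim: s => [|j s [I' sI]].
  exists (fun p => p = 1) => x; split=> [[]//|/(_ 1 erefl)/eqP].
  by rewrite /evalpt meval1 oner_eq0.
have [I0 HI] := zclosedU (Acl j) (ex_intro _ _ sI).
exists I0 => x; split=> [[i]|/HI].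
  by rewrite inE => /orP[/eqP->|si] Ai; apply/HI; [left|right; exists i].
case=> [Aj|[i si Ai]]; first by exists j; rewrite ?mem_head.
by exists i; rewrite // inE si orbT.
Qed.

Lemma zclosed_section (K : closedFieldType) m n (p : {mpoly K[m + n]})
    (A : 'rV[K]_n -> Prop) :
  zclosed (fun g => forall x, A x -> evalpt p (row_mx g x) = 0).
Proof.
pose F (x : 'rV[K]_n) (i : 'I_(m + n)) : {mpoly K[m]} :=
  match split i with inl a => 'X_a | inr b => (x 0 b)%:MP end.
have FE g x : polymap (F x) g = row_mx g x.
  apply/rowP=> i; rewrite mxE mxE /F /evalpt.
  by case: split => j; rewrite ?mevalXU ?mevalC.
exists (fun q => exists2 x, A x & q = mmap (@mpolyC m K) (F x) p) => g; split.
  by move=> H q [x Ax ->]; rewrite evalpt_mmap FE H.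
by move=> H x Ax; rewrite -FE -evalpt_mmap; apply: H; exists x.
Qed.

Section Strata.
Context (K : closedFieldType) (charK0 : [pchar K] =i pred0).
Context (n r : nat) (blk : 'I_n -> 'I_r) (l : 'I_n -> nat).
Context (l_gt1 : forall j, (1 < l j)%N) (r_gt1 : (1 < r)%N).
Local Notation f := (block_poly K blk l).
Local Notation X := (hypersurface f).

Let l_gt0 j : (0 < l j)%N. Proof. exact: ltnW. Qed.

Lemma regular_aut_zero_in_blocks (phi : X -> X) a :
  regular_aut phi -> zero_in_blocks blk (val a) -> zero_in_blocks blk (val (phi a)).
Proof.
case=> [[F phiF] [psi [[G psiG] phiK psiK]]] ab.
have xX (x : X) : evalpt f (val x) = 0 by apply/eqP/(valP x).
apply: (full_tangent_zero_in_blocks l_gt0 charK0 (xX _)).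
rewrite phiF; apply: (@full_tangent_iso _ _ _ F G).
- by move=> y /eqP yX; rewrite -(phiF (exist _ y yX)) xX.
- by move=> y /eqP yX; rewrite -(phiF (exist _ y yX)) -psiG phiK.
exact: zero_in_blocks_full_tangent.
Qed.

Definition transversal_of (J : 'I_r -> 'I_n) := forall k, blk (J k) = k.

Definition stratum (J : 'I_r -> 'I_n) (x : 'rV[K]_n) := forall k, x 0 (J k) = 0.

Lemma stratum_zero_in_blocks J x :
  transversal_of J -> stratum J x -> zero_in_blocks blk x.
Proof. by move=> JT xJ k; exists (J k). Qed.

(** If no coordinate of block [k] vanished on the image of the stratum, a
    single point of the stratum would make all of them nonzero by
    irreducibility, although its image is singular. *)
Lemma regular_aut_stratum_sub (phi : X -> X) J :
  regular_aut phi -> transversal_of J ->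
  exists2 J', transversal_of J' &
    forall x, stratum J (val x) -> stratum J' (val (phi x)).
Proof.
move=> phiA JT; have [[F phiF] _] := phiA.
have /fin_all_exists2[J' J'T J'P] : forall k, exists2 j, blk j = k &
    forall x : X, stratum J (val x) -> val (phi x) 0 j = 0.
  move=> k; apply: NNPP => noj.
  have [|x y t xJ yJ i|j|x xJ xn] :=
    @common_nonvanishing K n _ (enum [pred j | blk j == k]) F (stratum J).
  - by exists 0 => i; rewrite mxE.
  - by rewrite mxE horner_line !mxE xJ yJ subrr mulr0 addr0.
  - rewrite mem_enum inE => /eqP jk; apply: NNPP => nx; apply: noj.
    exists j => // x xJ; apply: NNPP => xj; apply: nx; exists (val x) => //.
    by apply/eqP => Fx; apply: xj; rewrite phiF mxE.
  have xb := stratum_zero_in_blocks JT xJ.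
  have /eqP xX := zero_in_blocks_hypersurface l_gt0 xb.
  have [j jk] := regular_aut_zero_in_blocks (a := exist _ x xX) phiA xb k.
  by rewrite phiF mxE => /eqP; apply/negP/xn; rewrite mem_enum inE jk.
by exists J' => // x xJ k; apply: J'P.
Qed.

(** The image of a stratum under an automorphism is again a whole stratum: the
    inverse maps the target [J'] into some stratum, which contains the original
    one and is therefore equal to it, as the generic points show. *)
Lemma regular_aut_stratum (phi : X -> X) J :
  regular_aut phi -> transversal_of J ->
  exists2 J', transversal_of J' & forall j,
    (forall x, stratum J (val x) -> val (phi x) 0 j = 0) <-> j = J' (blk j).
Proof.
move=> phiA JT; have [J' J'T phiJ] := regular_aut_stratum_sub phiA JT.
exists J' => // j; split=> [phij|-> x /phiJ]; last exact.
have [phiR [psi [psiR phiK psiK]]] := phiA.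
have psiA : regular_aut psi by split=> //; exists phi.
pose generic (I : 'I_r -> 'I_n) : 'rV[K]_n := \row_i (i != I (blk i))%:R.
have genericJ I : transversal_of I -> stratum I (generic I).
  by move=> IT k; rewrite mxE IT eqxx.
have generic0 I i : generic I 0 i = 0 -> i = I (blk i).
  by rewrite mxE; case: eqP => // _ /eqP; rewrite oner_eq0.
have toX I : transversal_of I -> exists x : X, val x = generic I.
  move=> IT; have xb := stratum_zero_in_blocks IT (genericJ I IT).
  have /eqP xX := zero_in_blocks_hypersurface l_gt0 xb.
  by exists (exist _ (generic I) xX).
have [I IT psiI] := regular_aut_stratum_sub psiA J'T.
have eIJ k : I k = J k.
  have [x xE] := toX J JT.
  have xJ : stratum J (val x) by rewrite xE; apply: genericJ.
  by have := psiI (phi x) (phiJ x xJ) k; rewrite phiK xE => /generic0; rewrite IT.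
have [y yE] := toX J' J'T; apply: generic0; rewrite -yE -(psiK y).
by apply: phij => k; rewrite -eIJ; apply: psiI; rewrite yE; apply: genericJ.
Qed.

(** For every [h] in the group, exactly one coordinate of block [k] vanishes on
    the image of the stratum [J] under [h].  The condition that this is [J k] and
    the condition that this is another coordinate of the block are both closed;
    the first one holds at the identity, so connectedness gives it everywhere. *)
Lemma connected_group_stratum m (G : affAlgGroup K m) (act : 'rV[K]_m -> X -> X)
    (F : 'I_n -> {mpoly K[m + n]}) J g x :
  zconnected G -> (forall y, act (ag_one G) y = y) ->
  (forall h, G h -> regular_aut (act h)) ->
  (forall h y, G h -> val (act h y) = polymap F (row_mx h (val y))) ->
  transversal_of J -> G g -> stratum J (val x) -> stratum J (val (act g x)).
Proof.
move=> Gconn act1 actA actF JT Gg xJ k.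
pose Z j h := forall y, stratum J y -> evalpt (F j) (row_mx h y) = 0.
have ZP j h : G h ->
    Z j h <-> (forall y : X, stratum J (val y) -> val (act h y) 0 j = 0).
  move=> Gh; split=> [Zj y yJ|H y yJ]; first by rewrite actF // mxE Zj.
  have yb := stratum_zero_in_blocks JT yJ.
  have /eqP yX := zero_in_blocks_hypersurface l_gt0 yb.
  by have := H (exist _ y yX) yJ; rewrite actF // mxE.
pose C h := exists2 j, j \in enum [pred j | (blk j == k) && (j != J k)] & Z j h.
have disj h : G h -> ~ (Z (J k) h /\ C h).
  move=> Gh [/(ZP _ _ Gh) ZJ [j]]; rewrite mem_enum inE => /andP[/eqP jk jJ].
  move/(ZP _ _ Gh); have [J' J'T J'P] := regular_aut_stratum (actA h Gh) JT.
  move/J'P=> jE; move/J'P: ZJ; rewrite JT => JE.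
  by rewrite jE JE jk eqxx in jJ.
have [||h Gh||ZG|CG] := Gconn (Z (J k)) C.
- exact: zclosed_section.
- by apply: zclosed_bigU => j; apply: zclosed_section.
- have [J' J'T J'P] := regular_aut_stratum (actA h Gh) JT.
  have ZJ' : Z (J' k) h by apply/ZP => //; apply/J'P; rewrite J'T.
  have [<-|J'J] := eqVneq (J' k) (J k); first by left.
  by right; exists (J' k); rewrite // mem_enum inE J'T eqxx.
- exact: disj.
- by have /ZP := ZG g Gg; apply.
have G1 := ag_one_in G; case: (disj _ G1); split; last exact: CG.
by apply/ZP => // y yJ; rewrite act1.
Qed.

(** A zero coordinate [i] of [a] belongs to a stratum through [a]: choose zero
    coordinates of [a] in the other blocks. *)
Lemma connected_group_zeros (S : (X -> X) -> Prop) phi a i :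
  connected_algebraic_subgroup S -> S phi ->
  zero_in_blocks blk (val a) -> val a 0 i = 0 -> val (phi a) 0 i = 0.
Proof.
move=> [Sreg [m [G [act [Gconn [act1 [_ [[F actF] [_ SG]]]]]]]]] /SG[g Gg phig].
move=> ab ai; rewrite phig.
have actA h : G h -> regular_aut (act h) by move=> Gh; apply/Sreg/SG; exists h.
have [J JT aJ] := fin_all_exists2 ab.
pose J' k := if k == blk i then i else J k.
suff /(_ (blk i)) : stratum J' (val (act g a)) by rewrite /J' eqxx.
apply: (connected_group_stratum Gconn act1 actA actF) => // k; rewrite /J'.
  by case: eqP.
by case: eqP.
Qed.

End Strata.

(** * Connected sets and the multiplicative group *)

(** A product of two polynomials that are nonzero on the curve is nonzero at
    some parameter, so the image of a cofinite subset of the line is even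
    irreducible.  The hypothesis only compares zeros, which leaves room for
    clearing denominators when [c] is a rational curve. *)
Lemma curve_zconnected (K : closedFieldType) n (Q : {poly K})
    (c : K -> 'rV[K]_n) (S : 'rV[K]_n -> Prop) :
  Q != 0 ->
  (forall x, S x <-> exists2 t, Q.[t] != 0 & x = c t) ->
  (forall p, exists P : {poly K}, forall t, Q.[t] != 0 ->
     (evalpt p (c t) == 0) = (P.[t] == 0)) ->
  zconnected S.
Proof.
move=> Q0 SE cP B C [I BI] [J CJ] SBC _.
case: (classic (forall x, S x -> B x)) => [|nSB]; first by left.
right=> _ /SE[t Qt ->]; apply/CJ => q Jq; apply: NNPP => qt; apply: nSB.
move=> _ /SE[u Qu ->]; apply/BI => p Ip.
have [P PE] := cP p; have [R RE] := cP q.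
apply/eqP; rewrite PE //.
have PR : P * R = 0.
  apply: (poly_eq0_off Q0) => z Qz; rewrite hornerM; apply/eqP.
  rewrite mulf_eq0 -PE // -RE //.
  have Sz : S (c z) by apply/SE; exists z.
  by case: (SBC _ Sz) => [/BI/(_ p Ip)->|/CJ/(_ q Jq)->]; rewrite eqxx ?orbT.
move/eqP: PR; rewrite mulf_eq0 => /orP[/eqP->|/eqP R0]; first by rewrite horner0.
by case: qt; apply/eqP; rewrite RE // R0 horner0.
Qed.

Lemma zclosed_preim (K : closedFieldType) m n (F : 'I_n -> {mpoly K[m]})
    (B : 'rV[K]_n -> Prop) :
  zclosed B -> zclosed (fun x => B (polymap F x)).
Proof.
move=> [I BI]; exists (fun q => exists2 p, I p & q = mmap (@mpolyC m K) F p) => x.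
split=> [/BI H q [p Ip ->]|H]; first by rewrite evalpt_mmap H.
by apply/BI => p Ip; rewrite -evalpt_mmap; apply: H; exists p.
Qed.

Lemma zconnected_image (K : closedFieldType) m n (F : 'I_n -> {mpoly K[m]})
    (S : 'rV[K]_m -> Prop) :
  zconnected S -> zconnected (fun y => exists2 x, S x & y = polymap F x).
Proof.
move=> Sc B C Bcl Ccl SBC disj.
have [||x Sx|x Sx|SB|SC] := Sc (fun x => B (polymap F x)) (fun x => C (polymap F x)).
- exact: zclosed_preim.
- exact: zclosed_preim.
- by apply: SBC; exists x.
- by apply: disj; exists x.
- by left=> _ [x Sx ->]; apply: SB.
- by right=> _ [x Sx ->]; apply: SC.
Qed.

Lemma zconnectedU (K : closedFieldType) n (S S' : 'rV[K]_n -> Prop) x :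
  S x -> S' x -> zconnected S -> zconnected S' ->
  zconnected (fun y => S y \/ S' y).
Proof.
move=> Sx S'x Sc S'c B C Bcl Ccl SBC disj.
have nx : ~ (B x /\ C x) by apply: disj; left.
have [||y Sy|y Sy|SB|SC] := Sc B C => //; [by apply: SBC; left|by apply: disj; left| |].
- have [||y Sy|y Sy|S'B|S'C] := S'c B C => //;
    [by apply: SBC; right|by apply: disj; right| |].
    by left=> y [/SB|/S'B].
  by case: nx; split; [apply: SB|apply: S'C].
- have [||y Sy|y Sy|S'B|S'C] := S'c B C => //;
    [by apply: SBC; right|by apply: disj; right| |].
    by case: nx; split; [apply: S'B|apply: SC].
  by right=> y [/SC|/S'C].
Qed.

Section MultiplicativeGroup.
Context (K : closedFieldType).

(** The multiplicative group is embedded in the plane as a hyperbola. *)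
Definition Gm_carrier (g : 'rV[K]_2) : Prop := g 0 0 * g 0 1 = 1.

Definition Gm_mul (g h : 'rV[K]_2) : 'rV[K]_2 := \row_i (g 0 i * h 0 i).

Definition Gm_inv (g : 'rV[K]_2) : 'rV[K]_2 := \row_i g 0 (rev_ord i).

Lemma Gm_rev (g : 'rV[K]_2) i : Gm_carrier g -> g 0 (rev_ord i) * g 0 i = 1.
Proof.
move=> <-; case/orP: (orbN (i == 0)) => [/eqP->|i0]; last first.
  have -> : i = 1 by apply/val_inj; case: i i0 => [[|[]]].
  by congr (g 0 _ * _); apply/val_inj.
by rewrite mulrC; congr (_ * g 0 _); apply/val_inj.
Qed.

Lemma Gm_closed : zclosed Gm_carrier.
Proof.
exists (fun p => p = 'X_0 * 'X_1 - 1) => g; rewrite /Gm_carrier.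
have E : evalpt ('X_0 * 'X_1 - 1) g = g 0 0 * g 0 1 - 1.
  by rewrite /evalpt rmorphB rmorphM rmorph1 /= !mevalXU.
split=> [H p ->|H]; first by rewrite E H subrr.
by apply/eqP; rewrite -subr_eq0 -E H.
Qed.

Lemma Gm_mul_in g h : Gm_carrier g -> Gm_carrier h -> Gm_carrier (Gm_mul g h).
Proof. by move=> Hg Hh; rewrite /Gm_carrier !mxE mulrACA Hg Hh mulr1. Qed.

Definition Gm : affAlgGroup K 2.
Proof.
refine (@AffAlgGroup K 2 Gm_carrier (const_mx 1) Gm_mul Gm_inv
          Gm_closed _ Gm_mul_in _ _ _ _ _ _).
- by rewrite /Gm_carrier !mxE mulr1.
- by move=> g Gg; rewrite /Gm_carrier !mxE -[RHS](Gm_rev 0 Gg);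
     congr (_ * g 0 _); apply/val_inj.
- by move=> g h k _ _ _; apply/rowP=> i; rewrite !mxE mulrA.
- by move=> g _; apply/rowP=> i; rewrite !mxE mul1r.
- by move=> g Gg; apply/rowP=> i; rewrite !mxE Gm_rev.
- exists (fun i => 'X_(lshift 2 i) * 'X_(rshift 2 i)) => g h _ _.
  by apply/rowP=> i; rewrite !mxE /evalpt rmorphM /= !mevalXU row_mxEl row_mxEr.
- exists (fun i => 'X_(rev_ord i)) => g _.
  by apply/rowP=> i; rewrite !mxE /evalpt mevalXU.
Defined.

Lemma Gm_zconnected : zconnected Gm.
Proof.
pose c (t : K) : 'rV[K]_2 := \row_i (if i == 0 then t else t^-1).
apply: (@curve_zconnected K 2 'X c); first by rewrite polyX_eq0.
  move=> g; split=> [Gg|[t]]; last first.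
    by rewrite hornerX => t0 ->; rewrite /= /Gm_carrier !mxE /= mulfV.
  have g0 : g 0 0 != 0.
    by apply: contra_eq_neq Gg => ->; rewrite mul0r eq_sym oner_eq0.
  exists (g 0 0); rewrite ?hornerX //; apply/rowP=> i; rewrite mxE.
  case: eqP => [-> //|/eqP i0].
  have -> : i = 1 by apply/val_inj; case: i i0 => [[|[]]].
  by apply: (mulfI g0); rewrite mulfV.
(* On the hyperbola every polynomial becomes a Laurent polynomial in t. *)
suff H (p : {mpoly K[2]}) : exists N (P : {poly K}), forall t, t != 0 ->
    t ^+ N * evalpt p (c t) = P.[t].
  move=> p; have [N [P NP]] := H p; exists P => t; rewrite hornerX => t0.
  by rewrite -NP // mulf_eq0 expf_eq0 (negPf t0) andbF.
move: p; apply: mpoly_gen_ind =>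
  [a|i|p q [N [P HP]] [M [Q HQ]]|p q [N [P HP]] [M [Q HQ]]].
- by exists 0%N, a%:P => t _; rewrite mul1r hornerC /evalpt mevalC.
- exists 1%N, (if i == 0 then 'X * 'X else 1) => t t0.
  rewrite /evalpt mevalXU mxE expr1; case: eqP => _; rewrite !hornerE //.
  by rewrite mulfV.
- exists (N + M)%N, ('X^M * P + 'X^N * Q) => t t0.
  rewrite !hornerE -HP // -HQ // /evalpt mevalD exprD mulrDr.
  by rewrite -!mulrA; congr (_ + _); rewrite mulrCA.
- exists (N + M)%N, (P * Q) => t t0.
  by rewrite hornerM -HP // -HQ // /evalpt mevalM exprD mulrACA.
Qed.

End MultiplicativeGroup.

(** * One-parameter subgroups and orbits *)

Lemma expr_gcdn1 (K : closedFieldType) (u : K) a b :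
  u ^+ a = 1 -> u ^+ b = 1 -> u ^+ gcdn a b = 1.
Proof.
case: (posnP a) => [->|a0] ua ub; first by rewrite gcd0n.
case: (egcdnP b a0) => km kn E _; have := congr1 (fun m => u ^+ m) E.
by rewrite exprD mulnC exprM ua expr1n mulnC exprM ub expr1n mul1r => <-.
Qed.

Definition same_zeros (K : closedFieldType) n (x y : 'rV[K]_n) :=
  forall i, (x 0 i == 0) = (y 0 i == 0).

Section OneParameter.
Context (K : closedFieldType) (charK0 : [pchar K] =i pred0).
Context (n r : nat) (blk : 'I_n -> 'I_r) (l : 'I_n -> nat).
Context (l_gt1 : forall j, (1 < l j)%N) (r_gt1 : (1 < r)%N).
Local Notation f := (block_poly K blk l).
Local Notation X := (hypersurface f).
Implicit Types (x y t : 'rV[K]_n) (e : 'I_n -> nat) (s : K).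

Let l_gt0 j : (0 < l j)%N. Proof. exact: ltnW. Qed.

Definition weight e k := (\sum_(j | blk j == k) e j * l j)%N.

(** The one-parameter subgroup with exponents [e] rescales [f] when all
    monomials of [f] have the same weight. *)
Definition balanced e := forall k k', weight e k = weight e k'.

Definition one_param e s : 'rV[K]_n := \row_j s ^+ e j.

Definition dilate t x : 'rV[K]_n := \row_i (t 0 i * x 0 i).

Lemma zero_in_blocks_same_zeros x y :
  same_zeros x y -> zero_in_blocks blk x -> zero_in_blocks blk y.
Proof.
move=> xy xb k; have [i ik /eqP xi] := xb k; exists i => //.
by apply/eqP; rewrite -xy.
Qed.

(** Choose a zero coordinate [J k] of [x] in each block.  All weights are made
    equal to the product of [l i] and all the [l (J k)]: the exponent of [i] is
    that of its companion [J (blk i)] in [f], and the exponents of the [J k]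
    compensate. *)
Lemma exists_weights x i : zero_in_blocks blk x -> x 0 i != 0 ->
  exists e, [/\ balanced e, (0 < e i)%N
    & forall j, j != i -> x 0 j != 0 -> e j = 0%N].
Proof.
move=> /fin_all_exists2[J JT xJ] xi.
pose m k := (\prod_(k' | k' != k) l (J k'))%N.
pose e j := if j == i then l (J (blk i)) else
  if j == J (blk j) then (l i * (m (blk j) - (blk j == blk i)))%N else 0%N.
have m_gt0 k : (0 < m k)%N by rewrite prodn_gt0.
have Ji k : J k != i by apply: contraNneq xi => <-; rewrite xJ.
exists e; split.
- suff H k : weight e k = (l i * \prod_k' l (J k'))%N by move=> k k'; rewrite !H.
  rewrite /weight (bigD1 (J k)) ?JT //= {1}/e (negPf (Ji k)) JT eqxx.
  rewrite [in RHS](bigD1 k) //= -/(m k).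
  have [ki|ki] := eqVneq k (blk i).
    rewrite (bigD1 i) /=; last by rewrite ki eqxx eq_sym Ji.
    rewrite big1 => [|j /andP[/andP[/eqP jk jJ] ji]]; last first.
      by rewrite /e (negPf ji) jk (negPf jJ).
    rewrite /e eqxx addn0 -ki mulnBr muln1 mulnBl [(l (J k) * l i)%N]mulnC subnK.
      by rewrite [(l (J k) * m k)%N]mulnC mulnA.
    by rewrite leq_mul2r leq_pmulr ?orbT.
  rewrite big1 => [|j /andP[/eqP jk jJ]]; last first.
    by rewrite /e jk (negPf jJ); case: eqP => // ji; rewrite -jk ji eqxx in ki.
  by rewrite addn0 subn0 -mulnA [(m k * _)%N]mulnC.
- by rewrite /e eqxx.
move=> j ji xj; rewrite /e (negPf ji); case: eqP => // jJ.
by rewrite jJ xJ eqxx in xj.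
Qed.

(** Dividing the exponents by their greatest common divisor makes the
    one-parameter subgroup a faithful image of the multiplicative group. *)
Lemma exists_primitive_weights x i : zero_in_blocks blk x -> x 0 i != 0 ->
  exists e, [/\ balanced e, \big[gcdn/0%N]_j e j = 1%N, (0 < e i)%N
    & forall j, j != i -> x 0 j != 0 -> e j = 0%N].
Proof.
move=> xb xi; have [e [eb ei e0]] := exists_weights xb xi.
pose g := \big[gcdn/0%N]_j e j.
have ge j : (g %| e j)%N by rewrite /g (bigD1 j) //= dvdn_gcdl.
have g0 : (0 < g)%N by apply: dvdn_gt0 ei (ge i).
have eg j : (g * (e j %/ g) = e j)%N by rewrite mulnC divnK.
exists (fun j => e j %/ g)%N; split.
- suff H k : (g * weight (fun j => e j %/ g) k)%N = weight e k.
    by move=> k k'; apply/eqP; rewrite -(eqn_pmul2l g0) !H (eb k k').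
  by rewrite /weight big_distrr; apply: eq_bigr => j _; rewrite /= mulnA eg.
- apply/eqP; rewrite -(eqn_pmul2l g0) muln1 -{2}/g.
  rewrite (big_morph (muln g) (id1 := 0%N) (op1 := gcdn)) ?muln0 //; last first.
    by move=> a b; rewrite muln_gcdr.
  by apply/eqP/eq_bigr => j _; rewrite eg.
- by rewrite divn_gt0 // dvdn_leq.
by move=> j ji xj; rewrite e0 ?div0n.
Qed.

Lemma prod_one_param (S : comNzRingType) (c : 'I_n -> S) e (u : S) k :
  \prod_(j | blk j == k) (u ^+ e j * c j) ^+ l j
  = u ^+ weight e k * \prod_(j | blk j == k) c j ^+ l j.
Proof.
rewrite /weight (big_morph (fun m => u ^+ m) (id1 := 1) (op1 := *%R)
          (fun a b => exprD _ a b) (expr0 _)) -big_split.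
by apply: eq_bigr => j _; rewrite exprMn -exprM.
Qed.

Lemma evalpt_one_param e s x : balanced e ->
  evalpt f x = 0 -> evalpt f (dilate (one_param e s) x) = 0.
Proof.
rewrite !evalpt_block_poly => eb fx.
transitivity (\sum_k s ^+ weight e k * \prod_(j | blk j == k) x 0 j ^+ l j).
  apply: eq_bigr => k _; rewrite -prod_one_param.
  by apply: eq_bigr => j _; rewrite !mxE.
pose w := weight e (Ordinal (ltnW r_gt1)).
under eq_bigr do rewrite (eb _ (Ordinal (ltnW r_gt1))) -/w.
by rewrite -mulr_sumr fx mulr0.
Qed.

(** All coordinates are 1 except the [i]-th, which solves b^(l i) = 1 - r.  The
    characteristic makes the right-hand side nonzero. *)
Lemma nonvanishing_point (i : 'I_n) : exists x : X, forall j, val x 0 j != 0.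
Proof.
have r1 : - r.-1%:R != 0 :> K.
  rewrite oppr_eq0; have /pcharf0P-> := charK0.
  by rewrite -lt0n -ltnS prednK // ltnW.
have [b bE] := root_exists (- r.-1%:R : K) (l_gt0 i).
pose x : 'rV[K]_n := \row_j (if j == i then b else 1).
suff /eqP fx : evalpt f x = 0.
  exists (exist _ x fx) => j; rewrite mxE; case: ifP => _; rewrite ?oner_eq0 //.
  by apply: contraNneq r1 => b0; rewrite -bE b0 expr0n gtn_eqF.
rewrite evalpt_block_poly (bigD1 (blk i)) //= (bigD1 i) //=.
rewrite big1 => [|j /andP[_ ji]]; last by rewrite mxE (negPf ji) expr1n.
rewrite mxE eqxx mulr1 bE (eq_bigr (fun => 1)) => [|k ki]; last first.
  rewrite big1 // => j /eqP jk; rewrite mxE; case: eqP => [ji|_]; rewrite ?expr1n //.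
  by rewrite -jk ji eqxx in ki.
by rewrite sumr_const cardC1 card_ord addNr.
Qed.

Lemma torus_act_polyE t p :
  torus_act_poly t p = mmap (@mpolyC n K) (fun j => t 0 j *: 'X_j) p.
Proof.
rewrite /torus_act_poly /comp_mpoly; apply: eq_bigr => m _; congr (_ * _).
by apply: eq_bigr => j _; rewrite tnth_mktuple.
Qed.

Lemma torusH_one_param e s : balanced e -> s != 0 -> torusH f (one_param e s).
Proof.
move=> eb s0; split=> [i|]; first by rewrite mxE expf_neq0.
pose w := weight e (Ordinal (ltnW r_gt1)).
exists (s ^+ w); rewrite torus_act_polyE mmap_block_poly scaler_sumr.
apply: eq_bigr => k _; rewrite -mul_mpolyC.
transitivity (\prod_(j | blk j == k) (s%:MP ^+ e j * 'X_j) ^+ l j : {mpoly K[n]}).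
  by apply: eq_bigr => j _; rewrite mxE -mul_mpolyC rmorphXn.
by rewrite prod_one_param /w (eb _ k) rmorphXn.
Qed.

Lemma torusT_one_param e s : balanced e -> s != 0 -> torusT f (one_param e s).
Proof.
move=> eb s0; exists (fun t => exists2 z, z != 0 & t = one_param e z); split.
- by move=> _ [z z0 ->]; apply: torusH_one_param.
- apply: (@curve_zconnected _ _ 'X (one_param e)); first by rewrite polyX_eq0.
    by move=> t; split=> -[z]; rewrite ?hornerX => z0 ->; exists z; rewrite ?hornerX.
  move=> p; exists (along (fun j => 'X^(e j)) p) => z _; rewrite horner_along.
  by congr (evalpt p _ == 0); apply/rowP=> j; rewrite !mxE hornerXn.
- by exists 1; rewrite ?oner_eq0 //; apply/rowP=> j; rewrite !mxE expr1n.
by exists s.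
Qed.

Lemma torusH_mul t u : torusH f t -> torusH f u -> torusH f (dilate t u).
Proof.
move=> [t0 [c ct]] [u0 [d du]]; split=> [i|]; first by rewrite mxE mulf_neq0.
exists (c * d).
have -> : torus_act_poly (dilate t u) f = torus_act_poly t (torus_act_poly u f).
  rewrite !torus_act_polyE; apply/esym; apply: rmorph_mmap => [a|i].
    by rewrite /= mmapC.
  by rewrite /= mmapZ mmapX mmap1U mxE mul_mpolyC scalerA mulrC.
by rewrite du torus_act_polyE mmapZ -torus_act_polyE ct mul_mpolyC scalerA mulrC.
Qed.

(** If [S] and [S'] are connected sets joining 1 to [t] and to [u], then [S] and
    the translate of [S'] by [t] meet at [t], and their union joins 1 to the
    product. *)
Lemma torusT_mul t u : torusT f t -> torusT f u -> torusT f (dilate t u).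
Proof.
move=> [S [SH Sc S1 St]] [S' [S'H S'c S'1 S'u]].
pose F j : {mpoly K[n]} := t 0 j *: 'X_j.
have FE x : polymap F x = dilate t x.
  by apply/rowP=> j; rewrite !mxE /evalpt mevalZ mevalXU.
exists (fun y => S y \/ exists2 x, S' x & y = polymap F x); split.
- move=> y [/SH //|[x /S'H xH ->]]; rewrite FE.
  by apply: torusH_mul; first exact: SH.
- apply: (zconnectedU St) => //; last exact: zconnected_image.
  by exists (const_mx 1) => //; rewrite FE; apply/rowP=> j; rewrite !mxE mulr1.
- by left.
by right; exists u; rewrite ?FE.
Qed.

(** Weights without common divisor make the action of the multiplicative group
    faithful: by a point with nonzero coordinates, two elements with the same
    action have a quotient [u] with [u ^+ e j = 1] for all [j].  The index [i]
    guarantees that such a point exists. *)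
Lemma one_param_Aut_alg e s (a : X) (i : 'I_n) : balanced e ->
  \big[gcdn/0%N]_j e j = 1%N -> s != 0 ->
  exists2 phi, @Aut_alg K n f phi & val (phi a) = dilate (one_param e s) (val a).
Proof.
move=> eb e1 s0.
pose one_paramX z (x : X) : X := exist _ (dilate (one_param e z) (val x))
  (introT eqP (@evalpt_one_param e z (val x) eb (eqP (valP x)))).
pose act (g : 'rV[K]_2) := one_paramX (g 0 0).
have act1 (x : X) : act (const_mx 1) x = x.
  by apply/val_inj/rowP=> j; rewrite !mxE expr1n mul1r.
have actM g h (x : X) : act (Gm_mul g h) x = act g (act h x).
  by apply/val_inj/rowP=> j; rewrite !mxE exprMn mulrA.
have actR g : regular_self_map (act g).
  exists (fun j => (g 0 0 ^+ e j) *: 'X_j) => x.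
  by apply/rowP=> j; rewrite !mxE /evalpt mevalZ mevalXU.
have actK g : Gm_carrier g -> cancel (act g) (act (Gm_inv g)).
  move=> Gg x; rewrite -actM -[RHS]act1; congr (act _ x).
  by apply/rowP=> j; rewrite !mxE Gm_rev.
have actVK g : Gm_carrier g -> cancel (act (Gm_inv g)) (act g).
  move=> Gg x; rewrite -actM -[RHS]act1; congr (act _ x).
  by apply/rowP=> j; rewrite !mxE mulrC Gm_rev.
pose S phi := exists2 g, Gm_carrier g & phi =1 act g.
pose g0 : 'rV[K]_2 := \row_j (if j == 0 then s else s^-1).
exists (act g0); last by apply/rowP=> j; rewrite !mxE.
apply: (@Aut_alg_gen _ _ _ S); last first.
  by exists g0; rewrite // /Gm_carrier !mxE /= mulfV.
split=> [phi [g Gg phig]|].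
  split; first by have [F FE] := actR g; exists F => x; rewrite phig.
  exists (act (Gm_inv g)); split; first exact: actR.
    by move=> x; rewrite phig actK.
  by move=> x; rewrite phig actVK.
exists 2%N, (Gm K), act; split; first exact: Gm_zconnected.
split; first exact: act1.
split; first by move=> g h x _ _; apply: actM.
split; last split; last by [].
- exists (fun j => 'X_(lshift n 0) ^+ e j * 'X_(rshift 2 j)) => g x _.
  apply/rowP=> j; rewrite !mxE /evalpt rmorphM rmorphXn /= !mevalXU.
  by rewrite row_mxEl row_mxEr.
- move=> g h Gg Gh gh; have [x x0] := nonvanishing_point i.
  have h0 : h 0 0 != 0.
    by apply: contra_eq_neq Gh => ->; rewrite mul0r eq_sym oner_eq0.
  have eqj j : (g 0 0 / h 0 0) ^+ e j = 1.
    have /rowP/(_ j) := congr1 val (gh x); rewrite !mxE => /(mulIf (x0 j)) E.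
    by rewrite exprMn exprVn E mulfV // expf_neq0.
  have g1 : g 0 0 = h 0 0.
    apply: divr1_eq; rewrite -[LHS]expr1; move: (g 0 0 / h 0 0) eqj => u eqj.
    rewrite -e1; elim/big_ind: _ => // c d; exact: expr_gcdn1.
  apply/rowP=> j; case: (eqVneq j 0) => [-> //|j0].
  have -> : j = 1 by apply/val_inj; case: j j0 => [[|[]]].
  by apply: (mulfI h0); rewrite Gh -g1 Gg.
Qed.

(** Induction on the number of coordinates where [x] and [y] differ: a
    one-parameter subgroup corrects one nonzero coordinate and leaves the other
    nonzero ones unchanged.  It serves for both kinds of orbits. *)
Lemma same_zeros_ind (R : 'rV[K]_n -> 'rV[K]_n -> Prop) :
  (forall x, zero_in_blocks blk x -> R x x) ->
  (forall x y z, R x y -> R y z -> R x z) ->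
  (forall x (i : 'I_n) e s, zero_in_blocks blk x -> balanced e ->
     \big[gcdn/0%N]_j e j = 1%N -> s != 0 -> R x (dilate (one_param e s) x)) ->
  forall x y, zero_in_blocks blk x -> same_zeros x y -> R x y.
Proof.
move=> Rxx Rtrans Rstep x y.
have [m] := ubnP #|[pred i | x 0 i != y 0 i]|; elim: m x => // m IH x ltm xb xy.
case: (pickP [pred i | x 0 i != y 0 i]) => [i /= xyi|xyE]; last first.
  suff <- : x = y by apply: Rxx.
  by apply/rowP=> j; have /negbFE/eqP := xyE j.
have xi : x 0 i != 0.
  by apply: contraNneq xyi => xi; rewrite xi eq_sym -xy xi.
have yi : y 0 i != 0 by rewrite -xy.
have [e [eb e1 ei e0]] := exists_primitive_weights xb xi.
have [s sE] := root_exists (y 0 i / x 0 i) ei.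
have s0 : s != 0.
  apply/eqP=> s0; have : y 0 i / x 0 i != 0 by rewrite mulf_neq0 ?invr_eq0.
  by rewrite -sE s0 expr0n gtn_eqF // eqxx.
pose x' := dilate (one_param e s) x.
have x'E j : x' 0 j = if j == i then y 0 i else x 0 j.
  rewrite !mxE; case: eqP => [->|/eqP ji]; first by rewrite sE divfK.
  by have [->|xj] := eqVneq (x 0 j) 0; [rewrite mulr0|rewrite e0 // mul1r].
have xx' : same_zeros x x'.
  by move=> j; rewrite x'E; case: (j =P i) => // ->; rewrite xy.
apply: (Rtrans _ x'); first exact: Rstep.
apply: IH => [||j]; last by rewrite -xx'.
- rewrite -ltnS; apply: leq_trans ltm; rewrite ltnS; apply/proper_card/properP; split.
    by apply/subsetP=> j; rewrite !inE x'E; case: (j =P i) => // ->; rewrite eqxx.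
  by exists i; rewrite !inE // x'E eqxx eqxx.
exact: zero_in_blocks_same_zeros xx' xb.
Qed.

(** Singularity is assumed at [a] or at its image, so that the property passes
    to inverses. *)
Lemma Aut_alg_same_zeros phi : @Aut_alg K n f phi ->
  forall a, zero_in_blocks blk (val a) \/ zero_in_blocks blk (val (phi a)) ->
  same_zeros (val a) (val (phi a)).
Proof.
have szC x y : same_zeros x y -> same_zeros y x by move=> xy i; rewrite xy.
elim=> {phi} [S phi SG Sphi a|a _ //|phi psi _ IHphi _ IHpsi a
  |phi psi _ IH phiK psiK a].
- have [psi Spsi phiK] : exists2 psi, S psi & cancel phi psi.
    have [_ [m [G [act [_ [act1 [actM [_ [_ SE]]]]]]]]] := SG.
    have [g Gg phig] := (SE phi).1 Sphi; have Gi := ag_inv_in Gg.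
    exists (act (ag_inv G g)); first by apply/SE; exists (ag_inv G g).
    by move=> x; rewrite phig -actM // ag_mulVg // act1.
  have zeros := connected_group_zeros charK0 l_gt1 r_gt1 SG.
  have psi_meets b : zero_in_blocks blk (val b) -> zero_in_blocks blk (val (psi b)).
    exact: (regular_aut_zero_in_blocks charK0 l_gt1 r_gt1 (SG.1 _ Spsi)).
  move=> ab; have {}ab : zero_in_blocks blk (val a).
    by case: ab => // /psi_meets; rewrite phiK.
  have phib := regular_aut_zero_in_blocks charK0 l_gt1 r_gt1 (SG.1 _ Sphi) ab.
  move=> i; apply/eqP/eqP => [|phi0]; first exact: zeros.
  by rewrite -(phiK a); apply: zeros.
- case=> [ab|phib].
    have H := IHpsi a (or_introl ab).
    move=> i; rewrite H; apply: IHphi; left; exact: zero_in_blocks_same_zeros ab.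
  have H := IHphi (psi a) (or_intror phib).
  move=> i; rewrite -[in RHS]H; apply: IHpsi; right.
  exact: zero_in_blocks_same_zeros (szC _ _ H) phib.
move=> ab; apply: szC; rewrite -{2}(psiK a); apply: IH.
by rewrite psiK; case: ab; [right|left].
Qed.

Theorem block_poly_singular_orbit (a : X) : singular_point a ->
  forall b, Aut_alg_orbit a b <-> torusT_orbit f (val a) b.
Proof.
move=> /singular_full_tangent sa b.
have aX : evalpt f (val a) = 0 by apply/eqP/(valP a).
have ab : zero_in_blocks blk (val a) := full_tangent_zero_in_blocks l_gt0 charK0 aX sa.
split=> [[phi phiA <-]|[t [S [SH _ _ St]] ->]].
  have : same_zeros (val a) (val (phi a)) by apply: (Aut_alg_same_zeros phiA); left.
  apply: (same_zeros_ind (R := torusT_orbit f)) => //.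
  - move=> x _; exists (one_param (fun=> 0%N) 1).
      by apply: torusT_one_param; rewrite ?oner_eq0 // => k k'; rewrite /weight !big1.
    by apply/rowP=> i; rewrite !mxE mul1r.
  - move=> x y z [t tT ->] [u uT ->]; exists (dilate u t); first exact: torusT_mul.
    by apply/rowP=> i; rewrite !mxE mulrA.
  - by move=> x i e s _ eb _ s0; exists (one_param e s) => //; apply: torusT_one_param.
pose R (x y : 'rV[K]_n) := forall p : X, val p = x ->
  exists2 phi, @Aut_alg K n f phi & val (phi p) = y.
suff /(_ a erefl) : R (val a) (\row_i (t 0 i * val a 0 i)) by [].
have t0 := (SH t St).1.
apply: same_zeros_ind => //; last by move=> i; rewrite mxE mulf_eq0 (negPf (t0 i)).
- by move=> x _ p px; exists id => //; apply: Aut_alg_id.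
- move=> x y z xy yz p /xy[phi phiA /yz[psi psiA <-]].
  by exists (psi \o phi) => //; apply: Aut_alg_comp.
by move=> x i e s _ eb e1 s0 p <-; apply: one_param_Aut_alg.
Qed.

End OneParameter.

Lemma trinomial_block_poly (K : closedFieldType) n0 n1 n2 (l0 : 'I_n0 -> nat)
    (l1 : 'I_n1 -> nat) (l2 : 'I_n2 -> nat) :
  let split3 (j : 'I_(n0 + n1 + n2)) : 'I_3 * nat :=
    match split j with
    | inl j' => match split j' with inl i => (0, l0 i) | inr i => (1, l1 i) end
    | inr i => (2, l2 i)
    end in
  trinomial K l0 l1 l2 = block_poly K (fst \o split3) (snd \o split3).
Proof.
move=> split3; rewrite /block_poly !big_ord_recl big_ord0 addr0 addrA.
have splitl p q (i : 'I_p) : split (lshift q i) = inl i := unsplitK (inl i).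
have splitr p q (i : 'I_q) : split (rshift p i) = inr i := unsplitK (inr i).
have S0 i : split3 (lshift n2 (lshift n1 i)) = (0, l0 i).
  by rewrite /split3 !splitl.
have S1 i : split3 (lshift n2 (rshift n0 i)) = (1, l1 i).
  by rewrite /split3 splitl splitr.
have S2 i : split3 (rshift (n0 + n1) i) = (2, l2 i) by rewrite /split3 splitr.
rewrite /trinomial; congr (_ + _ + _); rewrite [RHS]big_mkcond !big_split_ord /=.
- rewrite [X in _ * X * _]big1 ?[X in _ * X]big1 => [|i _|i _]; rewrite ?S1 ?S2 //.
  by rewrite !mulr1; apply: eq_bigr => i _; rewrite S0.
- rewrite [X in X * _ * _]big1 ?[X in _ * X]big1 => [|i _|i _]; rewrite ?S0 ?S2 //.
  by rewrite mulr1 mul1r; apply: eq_bigr => i _; rewrite S1.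
rewrite [X in X * _ * _]big1 ?[X in _ * X * _]big1 => [|i _|i _]; rewrite ?S0 ?S1 //.
by rewrite !mul1r; apply: eq_bigr => i _; rewrite S2.
Qed.

Theorem theorem4p9 (K : closedFieldType) (charK0 : [pchar K] =i pred0)
    (n0 n1 n2 : nat) (n1_gt0 : (0 < n1)%N) (n2_gt0 : (0 < n2)%N)
    (l0 : 'I_n0 -> nat) (l1 : 'I_n1 -> nat) (l2 : 'I_n2 -> nat)
    (l0_ge2 : forall j, (2 <= l0 j)%N)
    (l1_ge2 : forall j, (2 <= l1 j)%N)
    (l2_ge2 : forall j, (2 <= l2 j)%N)
    (a : hypersurface (trinomial K l0 l1 l2)) :
  singular_point a ->
  forall b : 'rV[K]_(n0 + n1 + n2),
    Aut_alg_orbit a b <-> torusT_orbit (trinomial K l0 l1 l2) (val a) b.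
Proof.
move: a; rewrite trinomial_block_poly => a.
apply: block_poly_singular_orbit => // j /=.
case: split => [j'|i] /=; last exact: l2_ge2.
by case: split => i /=; [apply: l0_ge2|apply: l1_ge2].
Qed.
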